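(* Let $D\subseteq\mathbb{R}$ be a nonempty open interval, let $\varphi:D^+\to\mathbb{R}_+$, and let $f:D\to\mathbb{R}$. Then the following conditions are equivalent. (i) $f$ is $\varphi$-convex on $D$. (ii) For all $x,u,y\in D$ with $x<u<y$, $$\frac{f(u)-f(x)-\varphi(u-x)}{u-x}\leq \frac{f(y)-f(u)+\varphi(y-u)}{y-u}.$$ (iii) There exists a function $a:D\to\mathbb{R}$ such that, for all $x,u\in D$, $$f(x)-f(u)\geq a(u)(x-u)-\varphi(|x-u|).$$
   Context: $\mathbb{R}_+$ denotes the set of nonnegative reals. $D^+:=\{|x-y|:x,y\in D\}$. A function $f:D\to\mathbb{R}$ is called $\varphi$-convex on $D$ if $$f(tx+(1-t)y)\leq tf(x)+(1-t)f(y)+t\varphi\big((1-t)|x-y|\big)+(1-t)\varphi\big(t|x-y|\big)$$ for all $t\in[0,1]$ and all $x,y\in D$. *)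

(* Defs.v *)
From HB Require Import structures.
From mathcomp Require Import all_boot all_order all_algebra.
From mathcomp Require Import all_classical all_reals all_analysis.
Import Order.TTheory GRing.Theory Num.Theory.
Import numFieldNormedType.Exports.

Set Implicit Arguments.
Unset Strict Implicit.
Unset Printing Implicit Defensive.

Local Open Scope classical_set_scope.
Local Open Scope ring_scope.

Definition dist_set (R : realType) (D : set R) : set R :=
  [set `|x - y| | x in D & y in D].

(* Functions on D or on [dist_set D] are total functions on R whose values
   outside these sets are irrelevant: when D is an interval,
   t x + (1 - t) y lies in D, and t |x - y| and (1 - t) |x - y| lie in
   [dist_set D]. *)
Definition phi_convex_on (R : realType) (phi : R -> R) (D : set R) (f : R -> R)
    : Prop :=
  forall t x y : R, 0 <= t <= 1 -> D x -> D y ->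
    f (t * x + (1 - t) * y)
      <= t * f x + (1 - t) * f y
         + t * phi ((1 - t) * `|x - y|) + (1 - t) * phi (t * `|x - y|).

(* Main.v *)
Require Import Defs.
From HB Require Import structures.
From mathcomp Require Import all_boot all_order all_algebra.
From mathcomp Require Import all_classical all_reals all_analysis.
From mathcomp Require Import ring lra.
Import Order.TTheory GRing.Theory Num.Theory.
Import numFieldNormedType.Exports.

Set Implicit Arguments.
Unset Strict Implicit.
Unset Printing Implicit Defensive.

Local Open Scope classical_set_scope.
Local Open Scope ring_scope.

(** Fix u in D.  Condition (ii) bounds every left slope
    (f u - f x - phi (u - x)) / (u - x) by every right slope
    (f y - f u + phi (y - u)) / (y - u), and condition (iii) asks for a number
    a(u) lying between all left slopes and all right slopes: solving the
    inequality of (iii) for a(u) gives a lower bound when x < u and an upper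
    bound when x > u, while x = u only requires phi 0 >= 0.  By completeness
    the supremum of the left slopes is such a number; since D is open, u has
    points of D on both sides, so this set is nonempty and bounded above.

    Clearing denominators in (ii) and dividing by y - x gives the inequality of
    phi-convexity at u = t x + (1 - t) y with t = (y - u) / (y - x), for which
    (1 - t) |x - y| = u - x and t |x - y| = y - u; so (i) implies (ii).

    For (iii) to (i), the support inequalities at u = t x + (1 - t) y towards x
    and towards y are averaged with weights t and 1 - t: as
    t (x - u) + (1 - t) (y - u) = 0, the terms in a(u) cancel and only the
    phi terms remain. *)

Lemma open_has_left_right (R : realType) (D : set R) (u : R) :
  open D -> D u -> (exists2 x, D x & x < u) /\ (exists2 y, D y & u < y).
Proof.
move=> oD Du; have /nbhs_ballP[e /= e0 eD] : nbhs u D by exact: open_nbhs_nbhs.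
by split; [exists (u - e / 2)|exists (u + e / 2)];
  try (apply: eD; rewrite /ball /= ltr_norml; apply/andP; split); lra.
Qed.

Lemma convex_comb_interval (R : realType) (D : set R) (t x y : R) :
  is_interval D -> 0 <= t <= 1 -> D x -> D y -> D (t * x + (1 - t) * y).
Proof.
move=> iD /andP[t0 t1] Dx Dy.
by have [xy|/ltW yx] := leP x y;
  [apply: (iD _ _ Dx Dy)|apply: (iD _ _ Dy Dx)]; apply/andP; split; nra.
Qed.

Lemma phi_convex_slope_le (R : realType) (D : set R) (phi f : R -> R) :
  phi_convex_on phi D f ->
  forall x u y : R, D x -> D u -> D y -> x < u -> u < y ->
    (f u - f x - phi (u - x)) / (u - x)
      <= (f y - f u + phi (y - u)) / (y - u).
Proof.
move=> cf x u y Dx Du Dy xu uy.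
have ux0 : 0 < u - x by rewrite subr_gt0.
have yu0 : 0 < y - u by rewrite subr_gt0.
have yx0 : 0 < y - x by lra.
have yx_neq0 : y - x != 0 by rewrite gt_eqF.
pose t := (y - u) / (y - x).
have tE : t * (y - x) = y - u by rewrite divfK.
have t01 : 0 <= t <= 1.
  apply/andP; split; first by rewrite divr_ge0 // ltW.
  by rewrite ler_pdivrMr // mul1r; lra.
have := cf t x y t01 Dx Dy.
rewrite distrC (gtr0_norm yx0).
have -> : (1 - t) * (y - x) = u - x by rewrite mulrBl tE; ring.
have -> : t * x + (1 - t) * y = u.
  have -> : t * x + (1 - t) * y = y - t * (y - x) by ring.
  by rewrite tE subKr.
rewrite tE => /(ler_wpM2r (ltW yx0)).
(* Multiplied by y - x, the weights t and 1 - t become y - u and u - x. *)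
have -> : (t * f x + (1 - t) * f y + t * phi (u - x) + (1 - t) * phi (y - u))
    * (y - x) = t * (y - x) * (f x + phi (u - x))
      + (y - x - t * (y - x)) * (f y + phi (y - u)) by ring.
rewrite tE => fu_le.
by rewrite ler_pdivrMr // mulrAC ler_pdivlMr //; lra.
Qed.

(** The supremum of the left slopes is one choice of a(u); it separates left
    from right slopes as every right slope is an upper bound. *)
Lemma support_of_slope_le (R : realType) (D : set R) (phi f : R -> R) :
  open D -> (forall r, dist_set D r -> 0 <= phi r) ->
  (forall x u y : R, D x -> D u -> D y -> x < u -> u < y ->
    (f u - f x - phi (u - x)) / (u - x)
      <= (f y - f u + phi (y - u)) / (y - u)) ->
  exists a : R -> R, forall x u : R, D x -> D u ->
    a u * (x - u) - phi `|x - u| <= f x - f u.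
Proof.
move=> oD phi_ge0 slope_le.
pose left_slopes u :=
  [set (f u - f x - phi (u - x)) / (u - x) | x in [set x | D x /\ x < u]].
exists (fun u => sup (left_slopes u)) => x u Dx Du.
have ub_right y : D y -> u < y ->
    ubound (left_slopes u) ((f y - f u + phi (y - u)) / (y - u)).
  by move=> Dy uy _ [z [Dz zu] <-]; exact: slope_le.
have [[z Dz zu] [y Dy uy]] := open_has_left_right oD Du.
have left_neq0 : left_slopes u !=set0.
  by exists ((f u - f z - phi (u - z)) / (u - z)); exists z.
have left_bounded : has_ubound (left_slopes u).
  by eexists; exact: ub_right Dy uy.
case: (ltgtP x u) => [xu|ux|->].
- have : (f u - f x - phi (u - x)) / (u - x) <= sup (left_slopes u).
    by apply: ub_le_sup => //; exists x.
  by rewrite distrC gtr0_norm ?subr_gt0 // ler_pdivrMr ?subr_gt0 //; lra.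
- have : sup (left_slopes u) <= (f x - f u + phi (x - u)) / (x - u).
    by apply: ge_sup => //; exact: ub_right.
  by rewrite gtr0_norm ?subr_gt0 // ler_pdivlMr ?subr_gt0 //; lra.
- have : 0 <= phi `|u - u| by apply: phi_ge0; exists u => //; exists u.
  by rewrite !subrr; lra.
Qed.

Lemma phi_convex_of_support (R : realType) (D : set R) (phi f a : R -> R) :
  is_interval D ->
  (forall x u : R, D x -> D u -> a u * (x - u) - phi `|x - u| <= f x - f u) ->
  phi_convex_on phi D f.
Proof.
move=> iD support t x y t01 Dx Dy.
have Du := convex_comb_interval iD t01 Dx Dy.
case/andP: t01 => t0 t1; have s0 : 0 <= 1 - t by rewrite subr_ge0.
move: (support x _ Dx Du) (support y _ Dy Du).
set u := t * x + (1 - t) * y.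
have -> : x - u = (1 - t) * (x - y) by rewrite /u; ring.
have -> : y - u = t * (y - x) by rewrite /u; ring.
rewrite !normrM (ger0_norm t0) (ger0_norm s0) (distrC y x).
move=> /(ler_wpM2l t0) support_x /(ler_wpM2l s0) support_y.
by have := lerD support_x support_y; lra.
Qed.

Theorem theorem11 (R : realType) (D : set R)
    (D_nonempty : D !=set0) (D_open : open D) (D_interval : is_interval D)
    (phi : R -> R) (phi_ge0 : forall r, dist_set D r -> 0 <= phi r)
    (f : R -> R) :
  [<-> phi_convex_on phi D f;
       forall x u y : R, D x -> D u -> D y -> x < u -> u < y ->
         (f u - f x - phi (u - x)) / (u - x)
           <= (f y - f u + phi (y - u)) / (y - u);
       exists a : R -> R, forall x u : R, D x -> D u ->
         a u * (x - u) - phi `|x - u| <= f x - f u].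
Proof.
tfae.
- exact: phi_convex_slope_le.
- exact: support_of_slope_le.
- by move=> [a]; exact: phi_convex_of_support.
Qed.
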